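(* Let $K$ be a division ring, $S$ an automorphism of $K$ and $D$ an $S$-derivation of $K$, and let $R=K[t;S,D]$. A matrix $A\in M_n(K)$ is $(S,D)$-diagonalizable if and only if its last invariant factor $e_r\in R$ (taken monic) is a Wedderburn polynomial.
   Context: An $S$-derivation is an additive map $D:K\to K$ with $D(ab)=S(a)D(b)+D(a)b$. $R=K[t;S,D]$ is the Ore ring of skew polynomials $\sum a_it^i$ ($a_i\in K$) with $ta=S(a)t+D(a)$. For $f\in R$, $a\in K$ write $f=q\,(t-a)+b$ with $q\in R$, $b\in K$; then $f(a):=b$, and $V(f):=\{a\in K: f(a)=0\}$. A polynomial $f\in R$ is a Wedderburn polynomial if $f$ is monic and is of minimal degree amongst the nonzero polynomials of $R$ vanishing on $V(f)$. $S$ and $D$ are extended entrywise to matrices. Two matrices $A,B\in M_n(K)$ are $(S,D)$-similar if $B=S(P)AP^{-1}+D(P)P^{-1}$ for some $P\in GL_n(K)$; $A$ is $(S,D)$-diagonalizable if it is $(S,D)$-similar to a diagonal matrix. Invariant factors: since $S$ is an automorphism, $R$ is a left and right principal ideal domain. For $f,g\in R$, $f$ strongly divides $g$ (written $f\,||\,g$) if there is $c\in R$ with $cR=Rc$ such that $f$ left divides $c$ (i.e. $c\in fR$) and $c$ left divides $g$ (i.e. $g\in cR$). There are $P,Q\in GL_n(R)$ with $P(tI-A)Q$ diagonal, with each diagonal entry strongly dividing the next. The diagonal entries that are not units, listed in order and reindexed as $e_1,\dots,e_r$ (so $e_1\,||\,e_2\,||\cdots||\,e_r$), are the invariant factors of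 $A$ (they are determined up to similarity, $f\sim g$ meaning $R/Rf\cong R/Rg$ as left $R$-modules), and $e_r$ is the last one. *)

(* Defs.v *)
From HB Require Import structures.
From mathcomp Require Import all_boot all_order all_algebra boolp.

Set Implicit Arguments.
Unset Strict Implicit.
Unset Printing Implicit Defensive.

Import GRing.Theory.
Local Open Scope ring_scope.

Record sderivation (K : nzRingType) (S : {rmorphism K -> K}) := SDerivation {
  sderiv_fun :> {additive K -> K};
  sderivM : forall a b, sderiv_fun (a * b) = S a * sderiv_fun b + sderiv_fun a * b
}.

(* The Ore ring K[t; S, D].  The carrier is {poly K}, the coefficient list of
   \sum_i a_i t^i with the coefficients written on the left; only the additive
   structure is inherited from {poly K}, the product is skewmul below. *)
Definition skewpoly (K : nzRingType) (S : {rmorphism K -> K})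
  (D : sderivation S) : predArgType := {poly K}.

HB.instance Definition _ (K : nzRingType) (S : {rmorphism K -> K})
  (D : sderivation S) := GRing.Zmodule.copy (skewpoly D) {poly K}.

Section SkewRing.
Variables (K : nzRingType) (S : {rmorphism K -> K}) (D : sderivation S).
Implicit Types (f g h : {poly K}) (a b : K).

(* left multiplication by t: t (\sum a_i t^i) = \sum S(a_i) t^(i+1) + D(a_i) t^i *)
Definition tmul g : {poly K} := map_poly S g * 'X + map_poly D g.

(* (\sum a_i t^i) g = \sum a_i (t^i g) *)
Definition skewmul f g : {poly K} := \sum_(i < size f) f`_i *: iter i tmul g.

Lemma tmulD : {morph tmul : f g / f + g}.
Proof. by move=> f g; rewrite /tmul !raddfD mulrDl addrACA. Qed.

Lemma tmul0 : tmul 0 = 0.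
Proof. by rewrite /tmul !raddf0 mul0r addr0. Qed.

Lemma tmulZ a g : tmul (a *: g) = S a *: tmul g + D a *: g.
Proof.
apply/polyP=> i; rewrite /tmul !(coefD, coefZ, coefMX).
rewrite !coef_map_id0 ?raddf0 // !coefZ sderivM.
case: i => [|i] /=; first by rewrite !add0r.
by rewrite rmorphM mulrDr addrA.
Qed.

Lemma iter_tmulD n : {morph iter n tmul : f g / f + g}.
Proof. by elim: n => // n IH f g; rewrite !iterS IH tmulD. Qed.

Lemma iter_tmul0 n : iter n tmul 0 = 0.
Proof. by elim: n => // n IH; rewrite iterS IH tmul0. Qed.

Lemma skewmul_widen n f g :
  (size f <= n)%N -> skewmul f g = \sum_(i < n) f`_i *: iter i tmul g.
Proof.
move=> le_fn; rewrite /skewmul (big_ord_widen _ (fun i => f`_i *: iter i tmul g) le_fn).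
rewrite big_mkcond; apply: eq_bigr => i _; case: ltnP => // le_fi.
by rewrite nth_default // scale0r.
Qed.

Lemma skewmulDl : left_distributive skewmul +%R.
Proof.
move=> f g h; pose n := maxn (size f) (size g).
rewrite !(@skewmul_widen n) ?leq_maxl ?leq_maxr //; last exact: size_polyD.
by rewrite -big_split; apply: eq_bigr => i _; rewrite coefD scalerDl.
Qed.

Lemma skewmulDr : right_distributive skewmul +%R.
Proof.
move=> f g h; rewrite /skewmul -big_split; apply: eq_bigr => i _.
by rewrite iter_tmulD scalerDr.
Qed.

Lemma skewmul0l g : skewmul 0 g = 0.
Proof. by rewrite /skewmul size_poly0 big_ord0. Qed.

Lemma skewmulZl a f g : skewmul (a *: f) g = a *: skewmul f g.
Proof.
rewrite (@skewmul_widen (size f)) ?size_scale_leq // scaler_sumr.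
by apply: eq_bigr => i _; rewrite coefZ scalerA.
Qed.

Lemma skewmul_suml (I : Type) (r : seq I) (F : I -> {poly K}) g :
  skewmul (\sum_(i <- r) F i) g = \sum_(i <- r) skewmul (F i) g.
Proof.
by apply: (big_morph (skewmul^~ g)) => [f h|]; rewrite ?skewmulDl ?skewmul0l.
Qed.

Lemma tmul_sum (I : Type) (r : seq I) (F : I -> {poly K}) :
  tmul (\sum_(i <- r) F i) = \sum_(i <- r) tmul (F i).
Proof. exact: (big_morph tmul tmulD tmul0). Qed.

Lemma skewmulX f g : skewmul (f * 'X) g = skewmul f (tmul g).
Proof.
rewrite (@skewmul_widen (size f).+1); last first.
  by rewrite (leq_trans (size_polyMleq _ _)) // size_polyX addn2.
rewrite big_ord_recl coefMX /= scale0r add0r /skewmul.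
by apply: eq_bigr => i _; rewrite coefMX /= -iterS iterSr.
Qed.

Lemma skewmul_tmul f g : skewmul (tmul f) g = tmul (skewmul f g).
Proof.
rewrite {1}/tmul skewmulDl skewmulX.
rewrite (@skewmul_widen (size f) (map_poly S f)) ?size_poly //.
rewrite (@skewmul_widen (size f) (map_poly D f)) ?size_poly //.
rewrite /skewmul tmul_sum -big_split; apply: eq_bigr => i _ /=.
by rewrite !coef_map_id0 ?raddf0 // tmulZ -iterSr.
Qed.

Lemma skewmulA : associative skewmul.
Proof.
have itA n g h : skewmul (iter n tmul g) h = iter n tmul (skewmul g h).
  by elim: n => // n IH; rewrite !iterS skewmul_tmul IH.
move=> f g h; rewrite {2}/skewmul skewmul_suml {1}/skewmul.
by apply: eq_bigr => i _; rewrite skewmulZl itA.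
Qed.

Lemma skewmulC a g : skewmul a%:P g = a *: g.
Proof.
by rewrite (@skewmul_widen 1) ?size_polyC ?leq_b1 // big_ord1 coefC.
Qed.

Lemma skewmul1l : left_id 1%:P skewmul.
Proof. by move=> g; rewrite skewmulC scale1r. Qed.

Lemma sderiv1 : D 1 = 0.
Proof.
by apply: (addrI (D 1)); rewrite addr0 -[in RHS](mulr1 1) sderivM rmorph1 mulr1 mul1r.
Qed.

Lemma tmulXn n : tmul 'X^n = 'X^(n.+1).
Proof.
apply/polyP=> i; rewrite /tmul coefD coefMX !coef_map_id0 ?raddf0 // !coefXn.
have -> : D (i == n)%:R = 0 by case: eqP; rewrite ?sderiv1 ?raddf0.
case: i => [|i] /=; first by rewrite addr0.
by rewrite addr0 rmorph_nat eqSS.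
Qed.

Lemma iter_tmul1 n : iter n tmul 1 = 'X^n.
Proof. by elim: n => [|n IH]; rewrite ?expr0 // iterS IH tmulXn. Qed.

Lemma skewmul1r : right_id 1%:P skewmul.
Proof.
move=> f; rewrite /skewmul; under eq_bigr do rewrite iter_tmul1.
by rewrite -poly_def coefK.
Qed.

End SkewRing.

HB.instance Definition _ (K : nzRingType) (S : {rmorphism K -> K})
    (D : sderivation S) :=
  GRing.Zmodule_isNzRing.Build (skewpoly D) (@skewmulA K S D)
    (@skewmul1l K S D) (@skewmul1r K S D) (@skewmulDl K S D)
    (@skewmulDr K S D) (oner_neq0 {poly K}).

Section SkewTheory.
Variables (K : nzRingType) (S : {rmorphism K -> K}) (D : sderivation S).
Local Notation R := (skewpoly D).

Definition skewC (a : K) : R := a%:P.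
Definition skewt : R := ('X : {poly K}).

Lemma skewt_def a : skewt * skewC a = skewC (S a) * skewt + skewC (D a).
Proof.
rewrite [LHS](_ : _ = tmul D a%:P); last first.
  rewrite /GRing.mul /= /skewt (@skewmul_widen _ _ _ 2) ?size_polyX //.
  by rewrite big_ord_recl big_ord1 !coefX /= scale0r add0r scale1r.
rewrite [X in _ = X + _](skewmulC D (S a) 'X) /tmul !map_polyC /= mul_polyC.
by [].
Qed.

Lemma skewC1 : skewC 1 = 1.
Proof. by []. Qed.

Lemma skewCD a b : skewC (a + b) = skewC a + skewC b.
Proof. exact: polyCD. Qed.

Lemma skewCM a b : skewC (a * b) = skewC a * skewC b.
Proof. by rewrite [RHS](skewmulC D a b%:P) /skewC polyCM mul_polyC. Qed.

Lemma skewt_exp n : skewt ^+ n = ('X^n : {poly K}).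
Proof.
elim: n => [|n IH]; first by rewrite !expr0.
rewrite exprS IH /GRing.mul /= /skewt (@skewmul_widen _ _ _ 2) ?size_polyX //.
by rewrite big_ord_recl big_ord1 !coefX /= scale0r add0r scale1r tmulXn.
Qed.

Lemma skewpolyE (f : R) :
  f = \sum_(i < size (f : {poly K})) skewC (f : {poly K})`_i * skewt ^+ i.
Proof.
rewrite -[LHS](coefK (f : {poly K})) poly_def; apply: eq_bigr => i _.
by rewrite skewt_exp; symmetry; apply: skewmulC.
Qed.

(* skeweval f a b means f(a) = b *)
Definition skeweval (f : R) (a b : K) : Prop :=
  exists q : R, f = q * (skewt - skewC a) + skewC b.

(* a \in V(f) *)
Definition skewV (f : R) (a : K) : Prop := skeweval f a 0.

Lemma skeweval_ex f a : exists b, skeweval f a b.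
Proof.
have evD g h b c : skeweval g a b -> skeweval h a c -> skeweval (g + h) a (b + c).
  move=> [p ->] [q ->]; exists (p + q).
  by rewrite skewCD mulrDl addrACA.
have evC c g b : skeweval g a b -> skeweval (skewC c * g) a (c * b).
  by case=> q ->; exists (skewC c * q); rewrite skewCM mulrDr mulrA.
have ev0 : skeweval 0 a 0 by exists 0; rewrite mul0r add0r.
have evt n : exists b, skeweval (skewt ^+ n) a b.
  elim: n => [|n [b [q Eq]]]; first by exists 1, 0; rewrite mul0r add0r.
  exists (S b * a + D b), (skewt * q + skewC (S b)).
  rewrite exprS Eq mulrDr mulrA skewt_def mulrDl -!addrA; congr (_ + _).
  by rewrite mulrBr skewCD skewCM [RHS]addrA subrK.
rewrite (skewpolyE f).
apply: (big_ind (fun g => exists b, skeweval g a b)); first by exists 0.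
  by move=> g h [b Eb] [c Ec]; exists (b + c); apply: evD.
by move=> i _; have [b Eb] := evt i; exists (f`_i * b); apply: evC.
Qed.

Lemma skeweval_uniq f a b c : skeweval f a b -> skeweval f a c -> b = c.
Proof.
have mulX (q : R) : q * skewt = ((q : {poly K}) * 'X : {poly K}).
  rewrite -[RHS](@skewmul1r _ _ D) skewmulX /skewt.
  by congr (skewmul D q _); symmetry; apply: (tmulXn D 0).
have szC n : (size (iter n (tmul D) a%:P) <= n.+1)%N.
  elim: n => [|n IH]; first by rewrite size_polyC leq_b1.
  rewrite iterS (leq_trans (size_polyD _ _)) // geq_max; apply/andP; split.
    rewrite (leq_trans (size_polyMleq _ _)) // size_polyX addn2 /=.
    by rewrite ltnS (leq_trans (size_poly _ _)).
  by rewrite (leq_trans (size_poly _ _)) // ltnW.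
have szM (q : R) : (size ((q * skewC a)%R : {poly K}) <= size (q : {poly K}))%N.
  rewrite (leq_trans (size_sum _ _ _)) //; apply/bigmax_leqP => i _.
  by rewrite (leq_trans (size_scale_leq _ _)) // (leq_trans (szC _)).
move=> [p ->] [q Eq].
have Epq : (p - q) * (skewt - skewC a) = skewC (c - b).
  rewrite mulrBl [skewC (c - b)]polyCB; apply/eqP.
  rewrite subr_eq -[X in _ == X + _]/(skewC c - skewC b) addrAC eq_sym subr_eq.
  by rewrite Eq addrC.
have [E0|nz] := eqVneq (p - q) 0.
  move: Epq; rewrite E0 mul0r => /esym/eqP.
  by rewrite [_ == _]polyC_eq0 subr_eq0 => /eqP.
pose d : {poly K} := (p - q)%R; pose w : {poly K} := ((p - q) * skewC a)%R.
have E : d * 'X - w = (c - b)%:P by move: Epq; rewrite mulrBr mulX.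
have szd : size (d * 'X) = (size d).+1 by rewrite size_mulX.
have : size (d * 'X - w) = (size d).+1.
  by rewrite size_polyDl szd // size_polyN ltnS; apply: szM.
rewrite E size_polyC => Esz; have := leq_b1 (c - b != 0).
rewrite Esz ltnS leqn0 size_poly_eq0 => /eqP d0.
by move: nz; rewrite -[p - q]/d d0 => /eqP.
Qed.
End SkewTheory.

Section Wedderburn.
Variables (K : nzRingType) (S : {rmorphism K -> K}) (D : sderivation S).
Local Notation R := (skewpoly D).

Definition skewmonic (f : R) : Prop := (f : {poly K}) \is monic.

Definition skewsize (f : R) : nat := size (f : {poly K}).

Definition wedderburn (f : R) : Prop :=
  skewmonic f /\
  forall g : R, g != 0 -> (forall a, skewV f a -> skewV g a) ->
    (skewsize f <= skewsize g)%N.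

End Wedderburn.

(* A monic associate of f when f is nonzero and K is a division ring. *)
Definition make_monic (K : unitRingType) (S : {rmorphism K -> K})
    (D : sderivation S) (f : skewpoly D) : skewpoly D :=
  skewC D (lead_coef (f : {poly K}))^-1 * f.

(* unitmx and invmx require a commutative ring. *)
Definition mx_inverse (R : nzRingType) n (P Q : 'M[R]_n) : Prop :=
  P *m Q = 1%:M /\ Q *m P = 1%:M.

Definition GLmx (R : nzRingType) n (P : 'M[R]_n) : Prop :=
  exists Q, mx_inverse P Q.

Section Similarity.
Variables (K : nzRingType) (S : {rmorphism K -> K}) (D : sderivation S).

Definition sd_similar n (A B : 'M[K]_n) : Prop :=
  exists P P' : 'M[K]_n, mx_inverse P P' /\
    B = map_mx S P *m A *m P' + map_mx D P *m P'.

Definition sd_diagonalizable n (A : 'M[K]_n) : Prop :=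
  exists B : 'M[K]_n, is_diag_mx B /\ sd_similar A B.

End Similarity.

Definition is_unit (R : nzRingType) (x : R) : Prop :=
  exists y, x * y = 1 /\ y * x = 1.

Definition strongly_divides (R : nzRingType) (f g : R) : Prop :=
  exists c : R,
    [/\ forall x, (exists y, x = c * y) <-> (exists y, x = y * c),
        exists y, c = f * y
      & exists y, g = c * y].

Definition invariant_factors (K : nzRingType) (S : {rmorphism K -> K})
    (D : sderivation S) n (A : 'M[K]_n) (es : seq (skewpoly D)) : Prop :=
  exists (P Q : 'M[skewpoly D]_n) (d : 'rV[skewpoly D]_n),
    [/\ GLmx P /\ GLmx Q,
        P *m ((skewt D)%:M - map_mx (skewC D) A) *m Q = diag_mx d,
        forall i j : 'I_n, j = i.+1 :> nat -> strongly_divides (d 0 i) (d 0 j)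
      & es = [seq x <- [seq d 0 i | i <- enum 'I_n] | `[< ~ is_unit x >]]].

(* Main.v *)
Require Import Defs.
From HB Require Import structures.
From mathcomp Require Import all_boot all_order all_algebra boolp.
Import GRing.Theory.
Local Open Scope ring_scope.
Set Implicit Arguments.
Unset Strict Implicit.
Unset Printing Implicit Defensive.

(** Write N for the left submodule R^n (tI - A) of R^n.  The quotient R^n / N is
the left K-space K^n on which t acts by v |-> S(v) A + D(v): modulo N every row
over R has exactly one representative with constant entries
([skewC_residue_ex], [skewC_residue_uniq]).  Under this identification the
relation B P = S(P) A + D(P) says that t acts on the rows of P through B, so A is
diagonalizable iff K^n has a basis of eigenvectors, that is of rows v with
t v = a v for some a in K ([sd_diagonalizableP]).

On the other hand P (tI - A) Q = diag(d_1, ..., d_n) says that R^n / N is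
generated by the rows q_i of Q^-1, with annihilators R d_i ([relmod_row]), and
that it is their direct sum.  Strong divisibility makes every d_i a right
divisor of the last invariant factor e ([strongly_divides_rdvd],
[last_invariant_factor]).

Suppose that there is an eigenbasis.  The generator q with annihilator R e is a
K-combination of it; the eigenvectors that occur in q, rescaled by their
coefficients, have eigenvalues a_j, and the independence of the basis shows that
g q = 0 iff g(a_j) = 0 for all these j ([eigenbasis_annihilator]).  So R e is the
set of polynomials vanishing at finitely many points, which is why no nonzero
polynomial of smaller degree vanishes on V(e) ([wedderburn_points]).

Suppose conversely that the monic associate f of e is a Wedderburn polynomial.
Adding the points of V(f) one at a time and taking least common left multiples
with t - a, one reaches a right divisor h of f that vanishes on V(f)
([eigen_generated_divisor]), and the minimality of deg f gives R h = R f.  Each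
step keeps the property that 1 is a sum of eigenvectors in R / R h
([eigen_generated_lcm]), because adjoining a new point splits off a summand
R / R(t - a).  Hence 1 is a sum of eigenvectors in R / R f, and since f q_i = 0
for every i, the generators q_i, and then all of R^n / N, are sums of
eigenvectors.  Steinitz exchange extracts an eigenbasis ([spanning_basis]). *)

Section SkewDomain.
Variables (K : unitRingType) (divK : forall x : K, x != 0 -> x \is a GRing.unit).
Variables (S : {rmorphism K -> K}) (D : sderivation S).
Local Notation R := (skewpoly D).
Local Notation C := (skewC D).
Local Notation t := (skewt D).
Implicit Types (f g h : R) (a b c : K).

(** * The skew polynomial ring is a domain with additive degree *)

Lemma skewC_is_zmod_morphism : zmod_morphism C.
Proof. by move=> a b; apply: polyCB. Qed.

Lemma skewC_is_monoid_morphism : monoid_morphism C.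
Proof. by split=> // a b; apply: skewCM. Qed.

HB.instance Definition _ :=
  GRing.isZmodMorphism.Build K R C skewC_is_zmod_morphism.
HB.instance Definition _ :=
  GRing.isMonoidMorphism.Build K R C skewC_is_monoid_morphism.

Lemma skewC_inj : injective C.
Proof. by move=> a b; apply: (@polyC_inj K). Qed.

Lemma rmorph_divring_eq0 a : (S a == 0) = (a == 0).
Proof.
apply/eqP/eqP=> [Sa0|->]; last exact: rmorph0.
apply/eqP/negP=> /negP /divK aU.
have := rmorph1 S; rewrite -{1}(mulrV aU) rmorphM Sa0 mul0r => /esym/eqP.
by rewrite oner_eq0.
Qed.

Lemma mulr_divring_eq0 a b : (a * b == 0) = (a == 0) || (b == 0).
Proof.
have [->|a0] := eqVneq a 0; first by rewrite mul0r eqxx.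
by rewrite -{1}(mulr0 a) (inj_eq (mulrI (divK a0))).
Qed.

Lemma skewsizeZ c f : c != 0 -> skewsize (C c * f) = skewsize f.
Proof.
move=> c0; have Zle b g : (skewsize (C b * g)%R <= skewsize g)%N.
  have -> : C b * g = (b *: (g : {poly K}) : {poly K}) := skewmulC D b g.
  exact: size_scale_leq.
apply/eqP; rewrite eqn_leq Zle /=.
by rewrite -{1}[f]mul1r -[1]/(C 1) -(mulVr (divK c0)) rmorphM -mulrA Zle.
Qed.

Lemma size_tmul (p : {poly K}) : p != 0 -> size (tmul D p) = (size p).+1.
Proof.
move=> p0; have szS : size (map_poly S p) = size p.
  by apply: size_map_poly_id0; rewrite rmorph_divring_eq0 lead_coef_eq0.
rewrite /tmul size_polyDl size_mulX ?szS -?size_poly_eq0 ?szS ?size_poly_eq0 //.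
by rewrite ltnS; apply: size_poly.
Qed.

Lemma size_iter_tmul n (p : {poly K}) :
  p != 0 -> size (iter n (tmul D) p) = (n + size p)%N.
Proof.
move=> p0; elim: n => // n IH; rewrite iterS size_tmul ?IH //.
by rewrite -size_poly_eq0 IH addn_eq0 size_poly_eq0 (negPf p0) andbF.
Qed.

Lemma skewsize_eq0 f : (skewsize f == 0%N) = (f == 0).
Proof. exact: size_poly_eq0. Qed.

(** Every power of t raises the degree by one because S, being a morphism of
division rings, kills no leading coefficient. *)
Lemma skewsizeM f g :
  f != 0 -> g != 0 -> (skewsize (f * g)%R).+1 = (skewsize f + skewsize g)%N.
Proof.
move=> f0 g0; have: skewsize f != 0%N by rewrite skewsize_eq0.
rewrite [f * g]/(skewmul D f g) /skewmul /skewsize.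
case Esz: (size (f : {poly K})) => [//|k] _; rewrite big_ord_recr /=.
have lf0 : (f : {poly K})`_k != 0.
  by have := lead_coef_eq0 (f : {poly K}); rewrite lead_coefE Esz /= => ->.
(* the top term has the full degree; the lower ones cannot cancel it *)
have Esum : size ((f : {poly K})`_k *: iter k (tmul D) g) = (k + size (g : {poly K}))%N.
  by rewrite -(size_iter_tmul k g0) -(skewmulC D); apply: skewsizeZ.
rewrite addrC size_polyDl Esum ?addSn // (leq_ltn_trans (size_sum _ _ _)) //.
have sg0 : (0 < size (g : {poly K}))%N by rewrite size_poly_gt0.
apply: (@leq_ltn_trans (k + size (g : {poly K})).-1); last first.
  by rewrite prednK // addn_gt0 sg0 orbT.
apply/bigmax_leqP => i _; rewrite (leq_trans (size_scale_leq _ _)) //.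
by rewrite size_iter_tmul // -ltnS prednK ?ltn_add2r // addn_gt0 sg0 orbT.
Qed.

Lemma skew_mulf_eq0 f g : f * g = 0 -> f = 0 \/ g = 0.
Proof.
move=> fg0; have [|f0] := eqVneq f 0; first by left.
have [|g0] := eqVneq g 0; first by right.
have := skewsizeM f0 g0; rewrite fg0 [skewsize 0]size_poly0.
have : (0 < skewsize f)%N by rewrite lt0n skewsize_eq0.
have : (0 < skewsize g)%N by rewrite lt0n skewsize_eq0.
by case: (skewsize f) => // k; case: (skewsize g) => // l; rewrite addnS.
Qed.

Lemma skew_mulIf h f g : h != 0 -> f * h = g * h -> f = g.
Proof.
move=> /eqP h0 /eqP; rewrite -subr_eq0 -mulrBl => /eqP /skew_mulf_eq0.
by case=> // /eqP; rewrite subr_eq0 => /eqP.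
Qed.

(** * Right divisibility *)

Definition rdvd h f := exists q, f = q * h.

Lemma rdvd_trans f g h : rdvd f g -> rdvd g h -> rdvd f h.
Proof. by move=> [p ->] [q ->]; exists (q * p); rewrite mulrA. Qed.

Lemma rdvdD h f g : rdvd h f -> rdvd h g -> rdvd h (f + g).
Proof. by move=> [p ->] [q ->]; exists (p + q); rewrite mulrDl. Qed.

Lemma rdvdMl h f g : rdvd h f -> rdvd h (g * f).
Proof. by move=> [p ->]; exists (g * p); rewrite mulrA. Qed.

Lemma rdvd_leq h f : rdvd h f -> f != 0 -> (skewsize h <= skewsize f)%N.
Proof.
move=> [q ->] qh0.
have q0 : q != 0 by apply: contraNneq qh0 => ->; rewrite mul0r.
have h0 : h != 0 by apply: contraNneq qh0 => ->; rewrite mulr0.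
rewrite -ltnS skewsizeM // -add1n leq_add2r.
by rewrite lt0n skewsize_eq0.
Qed.

(** The quotient has degree 0, so it is an invertible constant. *)
Lemma rdvd_geq h f : rdvd h f -> f != 0 -> (skewsize f <= skewsize h)%N -> rdvd f h.
Proof.
move=> [q Ef] f0; rewrite Ef.
have q0 : q != 0 by apply: contraNneq f0 => q0; rewrite Ef q0 mul0r.
have h0 : h != 0 by apply: contraNneq f0 => h0; rewrite Ef h0 mulr0.
rewrite -ltnS skewsizeM // -add1n leq_add2r => /size1_polyC Eq.
have {}Eq : q = C (q : {poly K})`_0 := Eq.
rewrite Eq; set c := (q : {poly K})`_0.
have c0 : c != 0 by apply: contraNneq q0 => c0; rewrite Eq -/c c0 rmorph0.
by exists (C c^-1); rewrite mulrA -rmorphM mulVr ?rmorph1 ?mul1r ?divK.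
Qed.

(** Strong divisibility is phrased with left divisors, but implies right
divisibility.  If c = f x with c R = R c, then c x = x' c = x' f x for some x', and cancelling x
gives c = x' f; likewise g = c y is a left multiple of c. *)
Lemma strongly_divides_rdvd f g : strongly_divides f g -> rdvd f g.
Proof.
have [->|g0] := eqVneq g 0; first by exists 0; rewrite mul0r.
move=> [c [cRRc [x Ec] [y Eg]]].
have c0 : c != 0 by apply: contraNneq g0 => c0; rewrite Eg c0 mul0r.
have x0 : x != 0 by apply: contraNneq c0 => x0; rewrite Ec x0 mulr0.
have [x' Ex'] : exists z, c * x = z * c by apply/cRRc; exists x.
have {}Ex' : c = x' * f.
  by apply: (skew_mulIf x0); rewrite Ex' {1}Ec mulrA.
have [y' Ey'] : exists z, c * y = z * c by apply/cRRc; exists y.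
by exists (y' * x'); rewrite Eg Ey' -mulrA -Ex'.
Qed.

(** * Evaluation and common left multiples *)

Lemma skewV_rdvd f a : skewV f a <-> rdvd (t - C a) f.
Proof. by split=> [[q ->]|[q ->]]; exists q; rewrite rmorph0 addr0. Qed.

(** The (S,D)-conjugate of a by c: the eigenvalue of c v when v has the
eigenvalue a and c is nonzero. *)
Definition sd_conj c a := S c * a * c^-1 + D c * c^-1.

(** If (t - a) v = 0 then (t - b) c v = 0 for the conjugate b of a by c;
at c = 0 both sides vanish, which covers zero coordinates in a basis. *)
Lemma skewt_conj c a : (t - C (sd_conj c a)) * C c = C (S c) * (t - C a).
Proof.
have [->|c0] := eqVneq c 0; first by rewrite !rmorph0 mulr0 mul0r.
rewrite mulrBl mulrBr skewt_def -!rmorphM /sd_conj mulrDl !mulrVK ?divK //.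
by rewrite rmorphD opprD [- _ - _]addrC addrA addrK.
Qed.

(** The least common left multiple of h and t - a when c = h(a) is nonzero.
Modulo R(t - a) the polynomial h is the constant c, so s h is in R(t - a) iff
s c is, iff s vanishes at the conjugate of a by c. *)
Lemma lcm_linear h a : ~ skewV h a -> exists2 c, c != 0 &
  [/\ rdvd (t - C a) (h - C c),
      rdvd (t - C a) ((t - C (sd_conj c a)) * h)
    & forall g, rdvd h g -> rdvd (t - C a) g ->
        rdvd ((t - C (sd_conj c a)) * h) g].
Proof.
move=> nVh; have [c [q Eh]] := skeweval_ex h a.
have c0 : c != 0 by apply/eqP=> c0; apply: nVh; exists q; rewrite Eh c0.
exists c => //; split.
- by exists q; rewrite Eh addrK.
- rewrite Eh mulrDr skewt_conj; apply: rdvdD; last by exists (C (S c)).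
  by exists ((t - C (sd_conj c a)) * q); rewrite mulrA.
move=> _ [s ->] [r Er].
have [e [s' Es]] := skeweval_ex s (sd_conj c a).
suff e0 : e = 0 by exists s'; rewrite mulrA {1}Es e0 rmorph0 addr0.
have Esc : s * C c = s' * C (S c) * (t - C a) + C (e * c).
  by rewrite {1}Es mulrDl -mulrA skewt_conj mulrA rmorphM.
have ec0 : skeweval (0 : R) a (e * c).
  exists (s * q + s' * C (S c) - r); rewrite mulrBl -Er Eh mulrDl
    [s * (_ + _)]mulrDr [s * (q * _)]mulrA.
  by rewrite Esc addrA opprD addrA subrr add0r addNr.
have zero0 : skeweval (0 : R) a 0 by exists 0; rewrite mul0r rmorph0 addr0.
have /eqP := skeweval_uniq ec0 zero0.
by rewrite mulr_divring_eq0 (negPf c0) orbF => /eqP.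
Qed.

Lemma skewsize_mulC_leq f c : (skewsize (f * C c)%R <= skewsize f)%N.
Proof.
have [->|f0] := eqVneq f 0; first by rewrite mul0r.
have [->|c0] := eqVneq c 0; first by rewrite rmorph0 mulr0 /skewsize size_poly0.
have szC : skewsize (C c) = 1 by rewrite /skewsize [size _]size_polyC c0.
by rewrite -ltnS skewsizeM ?szC ?addn1 // -skewsize_eq0 szC.
Qed.

Lemma linear_neq0 a : t - C a != 0.
Proof. by rewrite -skewsize_eq0 /skewsize [size _]size_XsubC. Qed.

Lemma skewsize_linearM a h :
  h != 0 -> skewsize ((t - C a) * h) = (skewsize h).+1.
Proof.
move=> h0; apply: succn_inj; rewrite skewsizeM ?linear_neq0 //.
by rewrite {1}/skewsize [size _]size_XsubC.
Qed.

Lemma linear_mul_neq0 a h : h != 0 -> (t - C a) * h != 0.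
Proof. by move=> h0; rewrite -skewsize_eq0 skewsize_linearM. Qed.

Lemma finite_common_multiple (s : seq K) :
  exists2 g : R, g != 0 & forall a, a \in s -> skewV g a.
Proof.
elim: s => [|a s [h h0 Vh]]; first by exists 1 => //; exact: (oner_neq0 R).
have [Vha|/lcm_linear [c _ [_ Va _]]] := EM (skewV h a).
  by exists h => // b; rewrite inE => /orP[/eqP->//|/Vh].
exists ((t - C (sd_conj c a)) * h); first exact: linear_mul_neq0.
move=> b; rewrite inE => /orP[/eqP->|/Vh Vb]; first exact/skewV_rdvd.
by apply/skewV_rdvd/rdvdMl/skewV_rdvd.
Qed.

(** * Sums of eigenvectors in a quotient module *)

Section EigenSpan.
Variable U : lmodType R.

(** The preimage in U of the sums of eigenvectors of t in U / N.  Working in U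
avoids forming the quotient. *)
Inductive eigspan (N : U -> Prop) : U -> Prop :=
| Eigspan_eigen a x : N ((t - C a) *: x) -> eigspan N x
| Eigspan_add x y : eigspan N x -> eigspan N y -> eigspan N (x + y).

Definition submodule (N : U -> Prop) :=
  [/\ N 0, forall x y, N x -> N y -> N (x + y) & forall f x, N x -> N (f *: x)].

Lemma eigspan_sub N x : submodule N -> N x -> eigspan N x.
Proof. by move=> [_ _ NZ] Nx; apply: (@Eigspan_eigen _ 0); apply: NZ. Qed.

Lemma eigspan_scaleC N c x : submodule N -> eigspan N x -> eigspan N (C c *: x).
Proof.
move=> [_ _ NZ]; elim=> {x} [a x Nx|x y _ IHx _ IHy].
  apply: (@Eigspan_eigen _ (sd_conj c a)).
  by rewrite scalerA skewt_conj -scalerA; apply: NZ.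
by rewrite scalerDr; apply: Eigspan_add.
Qed.

Lemma eigspan_scalet N x : submodule N -> eigspan N x -> eigspan N (t *: x).
Proof.
move=> Nsub; elim=> {x} [a x Nx|x y _ IHx _ IHy].
  rewrite -[t](subrK (C a)) scalerDl; apply: Eigspan_add.
    exact: eigspan_sub.
  by apply: eigspan_scaleC => //; apply: Eigspan_eigen Nx.
by rewrite scalerDr; apply: Eigspan_add.
Qed.

(** A multiple c x of an eigenvector is an eigenvector for a conjugate
eigenvalue, and t acts on an eigenvector as a scalar; hence the eigenvectors
generate an R-submodule and not just a subgroup. *)
Lemma eigspan_scale N f x : submodule N -> eigspan N x -> eigspan N (f *: x).
Proof.
move=> Nsub Ex; rewrite (skewpolyE f) scaler_suml.
apply: (big_ind (eigspan N)) => [||i _].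
- by apply: eigspan_sub => //; case: Nsub.
- exact: Eigspan_add.
rewrite -scalerA; apply: eigspan_scaleC => //.
elim: (nat_of_ord i) => [|k IH]; first by rewrite expr0 scale1r.
by rewrite exprS -scalerA; apply: eigspan_scalet.
Qed.

End EigenSpan.

(** Right multiplication by x is a homomorphism R / I -> U / N, so it preserves
sums of eigenvectors. *)
Lemma eigspan_mulr (U : lmodType R) (I : R^o -> Prop) (N : U -> Prop) x :
  (forall r : R, I r -> N (r *: x)) ->
  forall r : R, eigspan I r -> eigspan N (r *: x).
Proof.
move=> IN r; elim=> {r} [a r Ir|r s _ IHr _ IHs].
  by apply: (@Eigspan_eigen _ _ a); rewrite scalerA; apply: IN.
by rewrite scalerDl; apply: Eigspan_add.
Qed.

(** In R / R h the generator 1, hence every element, is a sum of eigenvectors. *)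
Definition eigen_generated h := eigspan (rdvd h : R^o -> Prop) 1.

(** Let h' be the least common left multiple of h and t - a.  Then R / R h' is
R / R h + R / R(t - a), and the two components of 1 are explicit:
c^-1 h lies in R h and is 1 modulo R(t - a), and e = 1 - c^-1 h is the reverse.
The first is an eigenvector, since (t - b) h = h' for the conjugate b of a.  As
h e is a multiple of h', right multiplication by e carries the decomposition of
1 in R / R h to one of e in R / R h'. *)
Lemma eigen_generated_lcm h a c : c != 0 -> rdvd (t - C a) (h - C c) ->
  (forall g, rdvd h g -> rdvd (t - C a) g ->
     rdvd ((t - C (sd_conj c a)) * h) g) ->
  eigen_generated h -> eigen_generated ((t - C (sd_conj c a)) * h).
Proof.
move=> c0 [q Eq] lcmP hgen; set h' := _ * h.
have Eh : h = q * (t - C a) + C c by rewrite -Eq subrK.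
pose e : R := 1 - C c^-1 * h.
have Ee : e = - (C c^-1 * q) * (t - C a).
  rewrite /e Eh mulrDr -rmorphM mulVr ?divK // rmorph1 opprD addrCA subrr addr0.
  by rewrite mulrA mulNr.
have he : rdvd h' (h * e).
  apply: lcmP; last by rewrite Ee mulrA; exists (h * - (C c^-1 * q)).
  by exists (1 - h * C c^-1); rewrite /e mulrBr mulr1 mulrBl mul1r mulrA.
rewrite /eigen_generated -[1](subrK (C c^-1 * h : R^o)); apply: Eigspan_add.
  rewrite -[_ - _]/e -[e]mul1r.
  apply: (eigspan_mulr (U := R^o) (I := rdvd h : R^o -> Prop)) => //.
  by move=> _ [r ->]; rewrite -[_ *: _]mulrA; apply: rdvdMl.
apply: (@Eigspan_eigen _ _ (sd_conj c^-1 (sd_conj c a))).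
by rewrite -[_ *: _]/(_ * _) mulrA skewt_conj -mulrA; apply: rdvdMl; exists 1; rewrite mul1r.
Qed.

(** A point of V(f) where h does not vanish enlarges h to a least common left
multiple, which still divides f; degrees make the process stop.  It starts from
h = 1, for which R / R h = 0. *)
Lemma eigen_generated_divisor f : f != 0 -> exists h,
  [/\ rdvd h f, eigen_generated h & forall a, skewV f a -> skewV h a].
Proof.
move=> f0.
suff grow h : h != 0 -> rdvd h f -> eigen_generated h -> exists h',
    [/\ rdvd h' f, eigen_generated h' & forall a, skewV f a -> skewV h' a].
  apply: (grow 1); first exact: (oner_neq0 R).
    by exists f; rewrite mulr1.
  by apply: (@Eigspan_eigen _ _ 0); exists (t - C 0).
have [m] := ubnP (skewsize f - skewsize h); elim: m h => // m IH h lem h0 hf hgen.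
have [Vh|] := EM (forall a, skewV f a -> skewV h a); first by exists h.
move/existsNP=> [a /not_implyP [Vfa /lcm_linear [c c0 [hc _ lcmP]]]].
have h'f : rdvd ((t - C (sd_conj c a)) * h) f by apply/lcmP/skewV_rdvd.
have := rdvd_leq h'f f0; rewrite skewsize_linearM // => lt_hf.
apply: (IH ((t - C (sd_conj c a)) * h)) => //.
- by rewrite skewsize_linearM // subnS -ltnS prednK // subn_gt0.
- exact: linear_mul_neq0.
- exact: eigen_generated_lcm.
Qed.

Lemma wedderburn_eigen_generated f : wedderburn f -> eigen_generated f.
Proof.
move=> [fmon fmin].
have f0 : f != 0 by apply: monic_neq0.
have [h [hf hgen Vh]] := eigen_generated_divisor f0.
have h0 : h != 0.
  by case: hf => q Ef; apply: contraNneq f0 => h0; rewrite Ef h0 mulr0.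
have fh : rdvd f h by apply: rdvd_geq => //; apply: fmin.
rewrite /eigen_generated -[1]mulr1.
apply: (eigspan_mulr (U := R^o) (I := rdvd h : R^o -> Prop)) => // r hr.
by rewrite -[_ *: _]/(r * 1) mulr1; apply: rdvd_trans hr.
Qed.

Lemma rdvd_make_monic f g : f != 0 -> rdvd (make_monic f) g <-> rdvd f g.
Proof.
move=> f0; have lf0 : lead_coef (f : {poly K}) != 0 by rewrite lead_coef_eq0.
split; apply: rdvd_trans; first by exists (C (lead_coef (f : {poly K}))^-1).
exists (C (lead_coef (f : {poly K}))).
by rewrite mulrA -rmorphM mulrV ?rmorph1 ?mul1r ?divK.
Qed.

Lemma skewmonic_make_monic f : f != 0 -> skewmonic (make_monic f).
Proof.
move=> f0; have lf0 : lead_coef (f : {poly K}) != 0 by rewrite lead_coef_eq0.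
rewrite /skewmonic monicE lead_coefE.
rewrite -[size _]/(skewsize _) skewsizeZ ?invr_eq0 //.
have -> : make_monic f = ((lead_coef (f : {poly K}))^-1 *: (f : {poly K}) : {poly K})
  := skewmulC D _ _.
by rewrite coefZ -lead_coefE mulVr ?divK.
Qed.


(** * The module R^n / R^n (tI - A) *)

Section Residue.
Variables (n : nat) (A : 'M[K]_n).
Implicit Types (u : 'rV[R]_n) (v : 'rV[K]_n).
Local Notation X := (t%:M - map_mx C A).

Definition relmod u := exists q : 'rV[R]_n, u = q *m X.

Lemma relmod_submodule : submodule relmod.
Proof.
split=> [|_ _ [p ->] [q ->]|f _ [q ->]]; first by exists 0; rewrite mul0mx.
  by exists (p + q); rewrite mulmxDl.
by exists (f *: q); rewrite scalemxAl.
Qed.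

Lemma relmodB u u' : relmod u -> relmod u' -> relmod (u - u').
Proof. by move=> [p ->] [q ->]; exists (p - q); rewrite mulmxBl. Qed.

(** The action of t on K^n = R^n / R^n (tI - A). *)
Definition tact v := map_mx S v *m A + map_mx D v.

Lemma mulmx_skewt u : u *m t%:M = \row_j (u 0 j * t).
Proof.
by apply/rowP=> j; rewrite -diag_const_mx mul_mx_diag !mxE.
Qed.

Lemma scale_skewt_map v :
  t *: map_mx C v = map_mx C (map_mx S v) *m X + map_mx C (tact v).
Proof.
rewrite mulmxBr mulmx_skewt -map_mxM -addrA addrC /tact map_mxD.
rewrite addrA addNr add0r addrC.
by apply/rowP=> j; rewrite !mxE skewt_def.
Qed.

(** If C v = q (tI - A), that is q t = q A + C v, then an entry of q of largest
degree is raised in degree on the left-hand side only, so q = 0. *)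
Lemma skewC_residue_uniq v : relmod (map_mx C v) -> v = 0.
Proof.
move=> [q]; rewrite mulmxBr mulmx_skewt => Eq.
suff q0 : q = 0.
  apply/rowP=> j; move/rowP/(_ j): Eq; rewrite q0 mul0mx !mxE mul0r subr0.
  exact: skewC_inj.
apply/eqP/rV0Pn => -[j0 qj0].
have [j _ jmax] := @arg_maxnP _ j0 xpredT (fun j => skewsize (q 0 j)) isT.
have qj : q 0 j != 0.
  by rewrite -skewsize_eq0 -lt0n (leq_trans _ (jmax j0 isT)) // lt0n skewsize_eq0.
move/rowP/(_ j): Eq; rewrite !mxE => /eqP; rewrite eq_sym subr_eq => /eqP Eq.
have sum_le (r : seq 'I_n) (F : 'I_n -> R) m :
    (forall k, (skewsize (F k) <= m)%N) ->
    (skewsize (\sum_(k <- r) F k)%R <= m)%N.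
  move=> Fm; apply: (big_ind (fun f : R => (skewsize f <= m)%N)) => //.
    by rewrite /skewsize size_poly0.
  move=> f g fm gm; apply: leq_trans (size_polyD f g) _.
  by rewrite geq_max; apply/andP; split.
have : (skewsize (q 0%R j) < skewsize (q 0 j * t)%R)%N.
  rewrite -ltnS skewsizeM //; last by rewrite -skewsize_eq0 /skewsize [size _]size_polyX.
  by rewrite /skewsize [size (skewt D)]size_polyX addn2.
rewrite Eq ltnNge => /negP; apply; apply: leq_trans (size_polyD _ _) _.
rewrite geq_max; apply/andP; split; last first.
  apply: sum_le => k; rewrite mxE; apply: leq_trans (jmax k isT).
  exact: skewsize_mulC_leq.
by rewrite (leq_trans (size_polyC_leq1 _)) // lt0n skewsize_eq0.
Qed.

(** The rows with a constant representative form an R-submodule, as t C(v) is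
congruent to C(tact v), and it contains the standard basis. *)
Lemma skewC_residue_ex u : exists v, relmod (u - map_mx C v).
Proof.
have [relD relZ] : (forall x y, relmod x -> relmod y -> relmod (x + y)) /\
    (forall f x, relmod x -> relmod (f *: x)) by have [] := relmod_submodule.
have resD u1 u2 : (exists v, relmod (u1 - map_mx C v)) ->
    (exists v, relmod (u2 - map_mx C v)) -> exists v, relmod (u1 + u2 - map_mx C v).
  move=> [v1 r1] [v2 r2]; exists (v1 + v2).
  by rewrite map_mxD opprD addrACA; apply: relD.
have resC c u1 : (exists v, relmod (u1 - map_mx C v)) ->
    exists v, relmod (C c *: u1 - map_mx C v).
  by move=> [v r]; exists (c *: v); rewrite map_mxZ -scalerBr; apply: relZ.
have rest u1 : (exists v, relmod (u1 - map_mx C v)) ->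
    exists v, relmod (t *: u1 - map_mx C v).
  move=> [v r]; exists (tact v).
  rewrite -[u1](subrK (map_mx C v)) scalerDr scale_skewt_map addrA addrK.
  by apply: relD; [apply: relZ | exists (map_mx C (map_mx S v))].
rewrite [u]row_sum_delta.
have res0 : exists v, relmod (0 - map_mx C v).
  by exists 0; exists 0; rewrite map_mx0 subr0 mul0mx.
apply: (big_ind (fun u : 'rV[R]_n => exists v, relmod (u - map_mx C v))) => // j _.
rewrite [u 0 j]skewpolyE scaler_suml.
apply: (big_ind (fun u : 'rV[R]_n => exists v, relmod (u - map_mx C v))) => // i _.
rewrite -scalerA; apply: resC.
elim: (nat_of_ord i) => [|k IH]; last by rewrite exprS -scalerA; apply: rest.
exists (delta_mx 0 j); exists 0; rewrite expr0 scale1r map_delta_mx.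
by rewrite subrr mul0mx.
Qed.

Definition eigenrow v := exists a, tact v = a *: v.

Lemma scale_linear_map a v :
  relmod ((t - C a) *: map_mx C v) <-> tact v = a *: v.
Proof.
have E : (t - C a) *: map_mx C v =
    map_mx C (map_mx S v) *m X + map_mx C (tact v - a *: v).
  by rewrite scalerBl scale_skewt_map -map_mxZ -addrA map_mxB.
split=> [/relmodB rel|Ev]; last first.
  by exists (map_mx C (map_mx S v)); rewrite E Ev subrr map_mx0 addr0.
apply/eqP; rewrite -subr_eq0; apply/eqP/skewC_residue_uniq.
have {}rel := rel _ (ex_intro _ (map_mx C (map_mx S v)) erefl).
by move: rel; rewrite E addrC addKr.
Qed.

Lemma eigspan_residue u : eigspan relmod u ->
  exists2 s : seq 'rV[K]_n, (forall v, v \in s -> eigenrow v) &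
    relmod (u - map_mx C (\sum_(v <- s) v)).
Proof.
have [_ relD relZ] := relmod_submodule.
elim=> {u} [a u ru|u1 u2 _ [s1 E1 r1] _ [s2 E2 r2]]; last first.
  exists (s1 ++ s2); last by rewrite big_cat map_mxD opprD addrACA; apply: relD.
  by move=> v; rewrite mem_cat => /orP[/E1|/E2].
have [v rv] := skewC_residue_ex u; exists [:: v]; last by rewrite big_seq1.
move=> w; rewrite inE => /eqP->; exists a; apply/scale_linear_map.
rewrite -[map_mx C v](subKr u) scalerBr; apply: relmodB => //.
exact: relZ.
Qed.

End Residue.

(** * Extracting a basis from a spanning family *)

Section EigenBasis.
Variables (n : nat) (E : 'rV[K]_n -> Prop).

Lemma sum_coef_neq0 (s : seq 'rV[K]_n) (Q : 'M[K]_n) i :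
  ((\sum_(v <- s) v) *m Q) 0 i != 0 -> exists2 v, v \in s & (v *m Q) 0 i != 0.
Proof.
apply: contraPP => nex; rewrite mulmx_suml summxE big1_seq ?eqxx // => v /= vs.
by apply/eqP; apply: contrapT => /negP vi; apply: nex; exists v.
Qed.

(** Steinitz exchange: row i of P may be replaced by any v whose i-th coordinate
in the basis P is nonzero.  With c the coordinates of v, P is multiplied by
1 + e_i (c - e_i), a rank-one change of the identity whose inverse is
1 - e_i c_i^-1 (c - e_i). *)
Lemma replace_row (P Q : 'M[K]_n) i v : mx_inverse P Q -> (v *m Q) 0 i != 0 ->
  exists P' Q', mx_inverse P' Q' /\
    forall j, row j P' = if j == i then v else row j P.
Proof.
set c := v *m Q => -[PQ QP] ci.
pose r := c - delta_mx 0 i; pose e : 'cV[K]_n := delta_mx i 0.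
have re : r *m e = (c 0 i - 1)%:M.
  by rewrite /r mulmxBl mul_delta_mx -!colE; apply/matrixP=> x y; rewrite !ord1 !mxE.
pose s := - (c 0 i)^-1 *: r.
have se : s *m e = (- (c 0 i)^-1 * (c 0 i - 1))%:M.
  by rewrite /s -scalemxAl re scale_scalar_mx.
have MM' : (1%:M + e *m r) *m (1%:M + e *m s) = 1%:M.
  rewrite mulmxDl mul1mx mulmxDr mulmx1 -mulmxA [r *m (e *m s)]mulmxA re.
  rewrite mul_scalar_mx -addrA -!mulmxDr scalerBl scale1r addrCA subrKC.
  by rewrite scalerA mulrN mulrV ?divK // scaleN1r subrr mulmx0 addr0.
have M'M : (1%:M + e *m s) *m (1%:M + e *m r) = 1%:M.
  rewrite mulmxDl mul1mx mulmxDr mulmx1 -mulmxA [s *m (e *m r)]mulmxA se.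
  rewrite mul_scalar_mx -addrA -!mulmxDr mulrBr mulr1 mulNr mulVr ?divK //.
  by rewrite scalerBl scaleN1r -/s addrA -opprD subrr mulmx0 addr0.
exists ((1%:M + e *m r) *m P), (Q *m (1%:M + e *m s)); split.
  split; first by rewrite mulmxA -[_ *m P *m Q]mulmxA PQ mulmx1.
  by rewrite mulmxA -[_ *m _ *m (_ + e *m r)]mulmxA M'M mulmx1.
move=> j; rewrite row_mul linearD /= row1 row_mul mulmxDl -rowE.
have [->|ji] := eqVneq j i.
  have -> : row i e = 1%:M.
    by apply/matrixP=> x y; rewrite !ord1 !mxE !eqxx.
  by rewrite mul1mx /r mulmxBl -rowE addrC subrK /c -mulmxA QP mulmx1.
have -> : row j e = 0 by apply/matrixP=> x y; rewrite !mxE (negPf ji).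
by rewrite !mul0mx addr0.
Qed.

(** J bounds the rows of P that still have to be replaced.  Row i of P is a sum of
elements of E, one of which has a nonzero i-th coordinate and can be exchanged
with it. *)
Lemma spanning_basis :
  (forall v, exists2 s : seq 'rV[K]_n, (forall w, w \in s -> E w) & v = \sum_(w <- s) w) ->
  exists P Q : 'M[K]_n, mx_inverse P Q /\ forall i, E (row i P).
Proof.
move=> Espan.
suff loop m (P Q : 'M[K]_n) (J : {set 'I_n}) : mx_inverse P Q ->
    (forall i, i \notin J -> E (row i P)) -> (#|J| <= m)%N ->
    exists P Q : 'M[K]_n, mx_inverse P Q /\ forall i, E (row i P).
  apply: (loop n 1%:M 1%:M setT).
  - by split; rewrite mul1mx.
  - by move=> i; rewrite inE.
  - by rewrite cardsT card_ord.
elim: m P Q J => [|m IH] P Q J PQ EJ.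
  rewrite leqn0 cards_eq0 => /eqP J0; exists P, Q; split=> // i.
  by apply: EJ; rewrite J0 inE.
have [J0 _|/set0Pn [i iJ] leJ] := eqVneq J set0.
  by apply: (IH P Q set0) => //; rewrite ?cards0 // -J0.
have [s Es Erow] := Espan (row i P).
have : ((\sum_(w <- s) w) *m Q) 0 i != 0.
  by rewrite -Erow -row_mul (proj1 PQ) row1 mxE !eqxx oner_eq0.
move=> /sum_coef_neq0 [v /Es Ev vi].
have [P' [Q' [PQ' rowP']]] := replace_row PQ vi.
apply: (IH P' Q' (J :\ i)) => //.
  move=> j; rewrite in_setD1 negb_and negbK rowP'.
  by case: eqP => //= _ /EJ.
by move: leJ; rewrite (cardsD1 i) iJ.
Qed.

End EigenBasis.

(** * Diagonalization and annihilators *)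

Section Diagonalization.
Variables (n : nat) (A : 'M[K]_n).
Local Notation X := (t%:M - map_mx C A).

Lemma tact_row (P : 'M[K]_n) i :
  tact A (row i P) = row i (map_mx S P *m A + map_mx D P).
Proof. by rewrite /tact !map_row -row_mul -linearD. Qed.

Lemma sd_diagonalizableP : sd_diagonalizable D A <->
  exists P Q : 'M[K]_n, mx_inverse P Q /\ forall i, eigenrow A (row i P).
Proof.
split=> [[B [/is_diag_mxP Bdiag [P [Q [[PQ QP] EB]]]]]|[P [Q [[PQ QP] eigP]]]].
  exists P, Q; split=> // i; exists (B i i).
  have EBP : B *m P = map_mx S P *m A + map_mx D P.
    by rewrite EB -mulmxDl -mulmxA QP mulmx1.
  rewrite tact_row -EBP row_mul mulmx_sum_row (bigD1 i) //= !mxE.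
  rewrite big1 ?addr0 // => j ji; rewrite mxE Bdiag ?scale0r //.
  by rewrite eq_sym.
have [b Eb] := choice eigP.
exists (diag_mx (\row_j b j)); split; first exact: diag_mx_is_diag.
exists P, Q; split=> //.
rewrite -mulmxDl -[LHS]mulmx1 -PQ mulmxA; congr (_ *m Q).
apply/row_matrixP=> i; rewrite -tact_row Eb row_mul row_diag_mx -scalemxAl -rowE.
by rewrite mxE.
Qed.

(** Write u = sum_j c_j p_j in the eigenbasis and let a_j be the conjugate of the
eigenvalue of p_j by c_j.  Then g u = sum_j g(a_j) c_j p_j, which vanishes iff
g(a_j) = 0 whenever c_j is nonzero; J selects these j. *)
Lemma eigenbasis_annihilator (P Q : 'M[K]_n) (u : 'rV[R]_n) :
  mx_inverse P Q -> (forall i, eigenrow A (row i P)) ->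
  exists (a : 'I_n -> K) (J : pred 'I_n), forall g,
    relmod A (g *: u) <-> forall j, J j -> rdvd (t - C (a j)) g.
Proof.
move=> [PQ QP] /choice [b Eb].
have [_ relD relZ] := relmod_submodule A.
have [v rv] := skewC_residue_ex A u.
have [c Ev] : exists c : 'rV[K]_n, v = \sum_j c 0 j *: row j P.
  by exists (v *m Q); rewrite -mulmx_sum_row -mulmxA QP mulmx1.
pose a j := sd_conj (c 0 j) (b j).
exists a, (fun j => c 0 j != 0) => g.
have [e Ee] := choice (fun j => skeweval_ex g (a j)).
pose w := \row_j (e j * c 0 j).
have rw : relmod A (g *: u - map_mx C (w *m P)).
  rewrite -[u](subrK (map_mx C v)) scalerDr -addrA; apply: (relD); first exact: relZ.
  rewrite Ev mulmx_sum_row !map_mx_sum scaler_sumr -sumrB.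
  apply: (big_ind (relmod A)) => [|//|j _]; first by case: (relmod_submodule A).
  have [q Eg] := Ee j.
  rewrite !map_mxZ scalerA Eg mxE rmorphM mulrDl scalerDl addrK.
  rewrite -mulrA skewt_conj mulrA -scalerA.
  by apply: (relZ); apply/scale_linear_map.
have -> : relmod A (g *: u) <-> w = 0.
  split=> [rgu|w0]; last by move: rw; rewrite w0 mul0mx map_mx0 subr0.
  rewrite -[w]mulmx1 -PQ mulmxA (@skewC_residue_uniq _ A (w *m P)) ?mul0mx //.
  by have := relmodB rgu rw; rewrite subKr.
split=> [w0 j cj|Vg].
  have [q Eg] := Ee j; exists q; rewrite {1}Eg.
  move/rowP/(_ j): w0; rewrite !mxE => /eqP; rewrite mulr_divring_eq0 (negPf cj).
  by rewrite orbF => /eqP->; rewrite rmorph0 addr0.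
apply/rowP=> j; rewrite !mxE; have [->|cj] := eqVneq (c 0 j) 0; first by rewrite mulr0.
have /skewV_rdvd Vj := Vg j cj.
by rewrite (skeweval_uniq (Ee j) Vj) mul0r.
Qed.

Variables (P P' Q Q' : 'M[R]_n) (d : 'rV[R]_n).
Hypotheses (PP' : mx_inverse P P') (QQ' : mx_inverse Q Q').
Hypothesis PXQ : P *m X *m Q = diag_mx d.

(** In the basis of R^n given by the rows of Q' = Q^-1 the submodule becomes
R d_1 + ... + R d_n, so d_i generates the annihilator of the i-th row. *)
Lemma relmod_row i g : relmod A (g *: row i Q') <-> rdvd (d 0 i) g.
Proof.
have [[_ P'P] [QQ'1 Q'Q]] := (PP', QQ').
split=> [[q Eq]|[z ->]].
  exists ((q *m P') 0 i).
  have XQ : X *m Q = P' *m diag_mx d by rewrite -PXQ !mulmxA P'P mul1mx.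
  have -> : g = ((g *: row i Q') *m Q) 0 i.
    by rewrite -scalemxAl -row_mul Q'Q row1 !mxE !eqxx mulr1.
  by rewrite Eq -mulmxA XQ mulmxA mul_mx_diag mxE.
exists (z *: row i P); rewrite -scalerA -scalemxAl; congr (z *: _).
rewrite -row_mul; have -> : P *m X = diag_mx d *m Q'.
  by rewrite -PXQ -mulmxA QQ'1 mulmx1.
by rewrite row_mul row_diag_mx -scalemxAl -rowE.
Qed.

End Diagonalization.

(** A nonzero polynomial vanishing on finitely many points always exists, so the
hypothesis forces f to be nonzero.  The points themselves lie in V(f), so that
whatever vanishes on V(f) is a multiple of f. *)
Lemma wedderburn_points f n (a : 'I_n -> K) (J : pred 'I_n) :
  (forall g, rdvd f g <-> forall j, J j -> rdvd (t - C (a j)) g) ->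
  wedderburn (make_monic f).
Proof.
move=> fP.
have f0 : f != 0.
  have [g g0 Vg] := finite_common_multiple [seq a j | j <- enum 'I_n].
  have [q Eg] : rdvd f g.
    by apply/fP=> j _; apply/skewV_rdvd/Vg/map_f; rewrite mem_enum.
  by apply: contraNneq g0 => f0; rewrite Eg f0 mulr0.
split; first exact: skewmonic_make_monic.
move=> g g0 Vg; apply: rdvd_leq => //; apply/rdvd_make_monic => //.
apply/fP=> j Jj; apply/skewV_rdvd/Vg/skewV_rdvd; move: j Jj; apply/fP.
by exists (C (lead_coef (f : {poly K}))^-1).
Qed.

(** * The last invariant factor *)

Lemma rcons_filter (T : Type) (p : pred T) (s es : seq T) e :
  [seq x <- s | p x] = rcons es e ->
  exists s1 s2, [/\ s = s1 ++ e :: s2, p e & all (predC p) s2].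
Proof.
elim/last_ind: s => [|s x IH]; first by case: es.
rewrite filter_rcons; case: ifPn => [px Es|px /IH].
  by have [_ <-] := rcons_inj Es; exists s, [::]; rewrite cats1.
move=> [s1 [s2 [-> pe ns2]]]; exists s1, (rcons s2 x).
by rewrite rcons_cat all_rcons /= px.
Qed.

Lemma is_unit_rdvd f g : is_unit f -> rdvd f g.
Proof. by move=> [f' [_ f'f]]; exists (g * f'); rewrite -mulrA f'f mulr1. Qed.

(** Every diagonal entry before e divides it along the chain, and every one after
it is a unit, which divides anything. *)
Lemma last_invariant_factor n (d : 'rV[R]_n) (es : seq R) e :
  (forall i j : 'I_n, j = i.+1 :> nat -> strongly_divides (d 0 i) (d 0 j)) ->
  rcons es e = [seq x <- [seq d 0 i | i <- enum 'I_n] | `[< ~ is_unit x >]] ->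
  exists2 m, e = d 0 m & forall i, rdvd (d 0 i) e.
Proof.
move=> dchain Ees; have [s1 [s2 [Es _ us2]]] := rcons_filter (esym Ees).
have szd : size [seq d 0 i | i <- enum 'I_n] = n by rewrite size_map size_enum_ord.
have ltm : (size s1 < n)%N by rewrite -szd Es size_cat /= addnS ltnS leq_addr.
have Ed (i : 'I_n) : d 0 i = nth 0 [seq d 0 i | i <- enum 'I_n] i.
  by rewrite (nth_map i) ?size_enum_ord ?nth_ord_enum.
pose m := Ordinal ltm.
have Em : e = d 0 m by rewrite Ed Es nth_cat ltnn subnn.
exists m => // i; have [le_im|lt_mi] := leqP i m; last first.
  apply: is_unit_rdvd; rewrite Ed Es nth_cat ltnNge (ltnW lt_mi) /=.
  have lts : ((i - size s1).-1 < size s2)%N.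
    have := ltn_ord i; rewrite -{2}szd Es size_cat /= => lti.
    by rewrite -ltnS prednK ?subn_gt0 // ltn_subLR // ltnW.
  have /allP /(_ _ (mem_nth 0 lts)) /= := us2.
  rewrite -{2}[(i - _)%N]prednK ?subn_gt0 //=.
  by move/asboolPn/contrapT.
rewrite Em; have [k Ek] : exists k, (i + k = m)%N by exists (m - i)%N; rewrite subnKC.
elim: k i {le_im} Ek => [|k IH] i Ek.
  have -> : i = m by apply: ord_inj; rewrite -Ek addn0.
  by exists 1; rewrite mul1r.
have lti : (i.+1 < n)%N by rewrite (leq_ltn_trans _ (ltn_ord m)) // -Ek addnS ltnS leq_addr.
apply: rdvd_trans (IH (Ordinal lti) _); last by rewrite /= addSn -addnS.
exact: strongly_divides_rdvd (dchain i (Ordinal lti) erefl).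
Qed.

(** * The criterion *)

Lemma diagonalizable_of_eigen_generated n (A : 'M[K]_n) (P P' Q Q' : 'M[R]_n) d er :
  mx_inverse P P' -> mx_inverse Q Q' ->
  P *m (t%:M - map_mx C A) *m Q = diag_mx d ->
  (forall i, rdvd (d 0 i) er) -> eigen_generated er -> sd_diagonalizable D A.
Proof.
move=> PP' QQ' PXQ der ergen; apply/sd_diagonalizableP.
have Nsub := relmod_submodule A.
have eigQ i : eigspan (relmod A) (row i Q').
  rewrite -[row i Q']scale1r; move: ergen; apply: eigspan_mulr => g erg.
  by apply/(relmod_row PP' QQ' PXQ); apply: rdvd_trans erg.
have eigall (u : 'rV[R]_n) : eigspan (relmod A) u.
  have [QQ'1 _] := QQ'.
  rewrite -[u]mulmx1 -QQ'1 mulmxA mulmx_sum_row.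
  apply: (big_ind (eigspan (relmod A))) => [||i _].
  - by apply: eigspan_sub => //; case: Nsub.
  - exact: Eigspan_add.
  - exact: eigspan_scale.
apply: spanning_basis => v.
have [s Es rs] := eigspan_residue (eigall (map_mx C v)).
exists s => //; apply/eqP; rewrite -subr_eq0; apply/eqP.
by apply: (@skewC_residue_uniq _ A); rewrite map_mxB.
Qed.

End SkewDomain.

Theorem theorem5p11 (K : unitRingType)
    (divK : forall x : K, x != 0 -> x \is a GRing.unit)
    (S : {rmorphism K -> K}) (bijS : bijective S) (D : sderivation S)
    (n : nat) (A : 'M[K]_n) (es : seq (skewpoly D)) (er : skewpoly D)
    (invA : invariant_factors A (rcons es er)) :
  sd_diagonalizable D A <-> wedderburn (make_monic er).
Proof.
have [P [Q [d [[[P' PP'] [Q' QQ']] PXQ dchain Ees]]]] := invA.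
have [m Em der] := last_invariant_factor divK dchain Ees.
split=> [/sd_diagonalizableP [U [V [UV eigU]]]|].
  have [a [J annP]] := eigenbasis_annihilator divK (row m Q') UV eigU.
  apply: (wedderburn_points divK (a := a) (J := J)) => g.
  by rewrite Em -(relmod_row PP' QQ' PXQ).
move=> W; have er0 : er != 0.
  apply: contraPneq (proj1 W) => ->.
  by rewrite /make_monic mulr0 /skewmonic monicE lead_coef0 eq_sym oner_eq0.
apply: (diagonalizable_of_eigen_generated divK PP' QQ' PXQ (er := make_monic er)) => [i|].
  by apply: rdvd_trans (der i) _; exists (skewC D (lead_coef (er : {poly K}))^-1).
exact: wedderburn_eigen_generated.
Qed.
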